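(* Let $K$ be a field of characteristic zero. The Nagata automorphism $F=(F_1,F_2,F_3):K^3\to K^3$ given by $$F_1=X_1-2(X_1X_3+X_2^2)X_2-(X_1X_3+X_2^2)^2X_3,\quad F_2=X_2+(X_1X_3+X_2^2)X_3,\quad F_3=X_3$$ is Pascal finite but not strongly nilpotent.
   Context: A polynomial map $F:K^n\to K^n$ is a tuple $F=(F_1,\dots,F_n)$ of polynomials $F_i\in K[X]=K[X_1,\dots,X_n]$; composition means substitution of polynomials. Pascal finite: for a polynomial map $F$ define $\Delta_F:K[X]^n\to K[X]^n$ by $\Delta_F(P)=P\circ F-P$. The map $F$ is Pascal finite if there exists a positive integer $m$ such that $\Delta_F^m(X)=0$, where $\Delta_F^m$ is the $m$-fold iterate of $\Delta_F$ and $X=(X_1,\dots,X_n)$ is the identity map. Strongly nilpotent: write $F=\mathrm{Id}+H$ with $H=(H_1,\dots,H_n)$ and let $J_H=(\partial H_i/\partial X_j)_{1\le i,j\le n}$ be the Jacobian matrix of $H$. Let $Y^{(1)}=(Y^{(1)}_1,\dots,Y^{(1)}_n),\dots,Y^{(n)}=(Y^{(n)}_1,\dots,Y^{(n)}_n)$ be $n$ sets of $n$ independent variables. The matrix $J_H$ is strongly nilpotent if the product $J_H(Y^{(1)})\cdots J_H(Y^{(n)})$ is the zero matrix (over the polynomial ring $K[Y^{(i)}_j: 1\le i,j\le n]$). The map $F=\mathrm{Id}+H$ is called strongly nilpotent if $J_H$ is strongly nilpotent. *)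

(* Defs.v *)
From mathcomp Require Export all_boot all_algebra.
From mathcomp.multinomials Require Export mpoly.

Set Implicit Arguments.
Unset Strict Implicit.
Unset Printing Implicit Defensive.

Import GRing.Theory.
Local Open Scope ring_scope.

Section PolyMap.

Variables (n : nat) (K : fieldType).

Definition polymap := (n.-tuple {mpoly K[n]})%type.

Definition polymap_id : polymap := [tuple 'X_i | i < n].

Definition polymap_comp (P F : polymap) : polymap :=
  [tuple tnth P i \mPo F | i < n].

Definition polymap_sub (P Q : polymap) : polymap :=
  [tuple tnth P i - tnth Q i | i < n].

Definition polymap0 : polymap := [tuple 0 | _ < n].

Definition Delta (F P : polymap) : polymap :=
  polymap_sub (polymap_comp P F) P.

Definition pascal_finite (F : polymap) : Prop :=
  exists2 m : nat, (0 < m)%N & iter m (Delta F) polymap_id = polymap0.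

Definition jacobian (H : polymap) : 'M[{mpoly K[n]}]_n :=
  \matrix_(i, j) (tnth H i)^`M(j).

(* The n sets of n variables are the n * n variables of {mpoly K[n * n]},
   numbered by the bijection mxvec_index : 'I_n -> 'I_n -> 'I_(n * n). *)
Definition Yvars (k : 'I_n) : n.-tuple {mpoly K[n * n]} :=
  [tuple 'X_(mxvec_index k j) | j < n].

Definition strongly_nilpotent_mx (J : 'M[{mpoly K[n]}]_n) : Prop :=
  \prod_(k < n) map_mx (fun p => p \mPo Yvars k) J = 0.

Definition strongly_nilpotent (F : polymap) : Prop :=
  strongly_nilpotent_mx (jacobian (polymap_sub F polymap_id)).

End PolyMap.

Definition nagata (K : fieldType) : polymap 3 K :=
  let X1 : {mpoly K[3]} := 'X_(@Ordinal 3 0 isT) in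
  let X2 : {mpoly K[3]} := 'X_(@Ordinal 3 1 isT) in
  let X3 : {mpoly K[3]} := 'X_(@Ordinal 3 2 isT) in
  [tuple X1 - 2%:R * (X1 * X3 + X2 ^+ 2) * X2 - (X1 * X3 + X2 ^+ 2) ^+ 2 * X3;
         X2 + (X1 * X3 + X2 ^+ 2) * X3;
         X3].

(* Main.v *)
(** With s = X1 X3 + X2^2, which the Nagata automorphism F leaves invariant,
    F is the exponential of the locally nilpotent derivation s D, where
    D X1 = - 2 X2, D X2 = X3 and D X3 = 0. As D^3 kills the variables, three
    iterations of Delta_F suffice.

    Let H = F - Id. The third row of J_H vanishes, and at the points
    (0, 0, 1) and (0, 1, 0), the upper left 2 x 2 block of J_H is E_21 and
    - 6 E_12 respectively; hence the product of J_H at (0, 0, 1), (0, 1, 0) and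
    (0, 0, 1) has - 6 as its (2, 1) entry. *)
Require Import Defs.
From mathcomp Require Import all_boot all_algebra ring.
From mathcomp.multinomials Require Import mpoly.

Set Implicit Arguments.
Unset Strict Implicit.
Unset Printing Implicit Defensive.

Import GRing.Theory.
Local Open Scope ring_scope.

Lemma tnth_Delta n (K : fieldType) (F P : polymap n K) i :
  tnth (Delta F P) i = (tnth P i \mPo F) - tnth P i.
Proof. by rewrite !tnth_mktuple. Qed.

Lemma comp_mpoly_tnth n (K : fieldType) (F : polymap n K) i :
  'X_i \mPo F = tnth F i.
Proof. by rewrite comp_mpolyXU -tnth_nth. Qed.

Lemma mderivXU n (R : nzRingType) (i j : 'I_n) :
  ('X_i : {mpoly R[n]})^`M(j) = (i == j)%:R.
Proof.
rewrite mderivX mnm1E; case: eqP => [->|_]; last by rewrite scale0r.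
rewrite scale1r -mpolyX0; congr 'X_[_].
by apply/mnmP => k; rewrite mnmBE subnn mnm0E.
Qed.

(** The sets of variables are independent, so each can be specialised to its own point [y k];
    evaluation is a ring morphism and passes through the matrix product. *)
Lemma meval_strongly_nilpotent n (K : fieldType) (F : polymap n K)
    (y : 'I_n -> 'I_n -> K) :
  strongly_nilpotent F ->
  \prod_(k < n) map_mx (meval (y k)) (jacobian (polymap_sub F (polymap_id n K)))
    = 0.
Proof.
set J := jacobian _ => J0.
(* All the points [y k] joined into one point of [K^(n * n)], in the numbering of [Yvars]. *)
pose v i := mxvec (\matrix_(k, j) y k j) 0 i.
rewrite -(map_mx0 (meval v)) -[in RHS]J0.
have -> : map_mx (meval v) (\prod_(k < n) map_mx (comp_mpoly (Yvars K k)) J) =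
    \prod_(k < n) map_mx (meval v) (map_mx (comp_mpoly (Yvars K k)) J).
  by apply: (big_morph _ (@map_mxM _ _ (meval v) n n n) (map_mx1 _ _)).
apply: eq_bigr => k _; apply/matrixP => i j; rewrite !mxE comp_mpoly_meval.
by apply: meval_eq => l; rewrite tnth_mktuple mevalXU /v mxvecE mxE.
Qed.

Section Nagata.

Variable K : fieldType.

Let i1 := @Ordinal 3 0 isT.
Let i2 := @Ordinal 3 1 isT.
Let i3 := @Ordinal 3 2 isT.
Let X1 : {mpoly K[3]} := 'X_i1.
Let X2 : {mpoly K[3]} := 'X_i2.
Let X3 : {mpoly K[3]} := 'X_i3.
Let s := X1 * X3 + X2 ^+ 2.

Lemma nagata_X1 : X1 \mPo nagata K = X1 - 2%:R * s * X2 - s ^+ 2 * X3.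
Proof. by rewrite comp_mpoly_tnth. Qed.

Lemma nagata_X2 : X2 \mPo nagata K = X2 + s * X3.
Proof. by rewrite comp_mpoly_tnth. Qed.

Lemma nagata_X3 : X3 \mPo nagata K = X3.
Proof. by rewrite comp_mpoly_tnth. Qed.

Lemma nagata_s : s \mPo nagata K = s.
Proof.
rewrite rmorphD rmorphM rmorphXn /= nagata_X1 nagata_X2 nagata_X3 /s; ring.
Qed.

Lemma nagata_pascal_finite : pascal_finite (nagata K).
Proof.
exists 3 => //; apply/eq_from_tnth => i.
rewrite /= !tnth_Delta !tnth_mktuple.
have : i \in [:: i1; i2; i3] by case: i => [[|[|[|]]]].
have simp := (nagata_X1, nagata_X2, nagata_X3, nagata_s).
have compM p q : p * q \mPo nagata K = (p \mPo nagata K) * (q \mPo nagata K).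
  exact: rmorphM.
rewrite !inE => /or3P[] /eqP->.
(* Since [s] and [X3] are invariant, the next difference is [- 2 s^2 X3], and the third is 0. *)
- have -> : ('X_i1 \mPo nagata K) - 'X_i1 = - (s * X2) *+ 2 - s * s * X3.
    by rewrite -/X1 simp; ring.
  rewrite !(simp, comp_mpolyB, comp_mpolyD, comp_mpolyN, comp_mpolyMn, compM).
  ring.
(* This difference is already invariant, so the second iterate vanishes. *)
- have -> : ('X_i2 \mPo nagata K) - 'X_i2 = s * X3 by rewrite -/X2 simp; ring.
  by rewrite !(simp, compM) subrr comp_mpoly0 subrr.
- by rewrite -/X3 nagata_X3 subrr !(comp_mpoly0, subr0).
Qed.

Let J v := map_mx (meval v) (jacobian (polymap_sub (nagata K) (polymap_id 3 K))).

(* The default values of the two [nth] provide the zero third row. *)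
Lemma nagata_jacobian (a b c : K) (t := a * c + b ^+ 2) :
  J (tnth [tuple a; b; c]) =
  \matrix_(i, j) (nth [::]
    [:: [:: - 2%:R * c * b - 2%:R * t * c ^+ 2;
            - 2%:R * t - 4%:R * b ^+ 2 - 4%:R * t * b * c;
            - 2%:R * a * b - 2%:R * t * a * c - t ^+ 2];
        [:: c ^+ 2; 2%:R * b * c; a * c + t]] i)`_j.
Proof.
apply/matrixP => i j; rewrite !mxE !tnth_mktuple.
have mderiv1 k : (1 : {mpoly K[3]})^`M(k) = 0 by rewrite -mpolyC1 mderivC.
have : i \in [:: i1; i2; i3] by case: i => [[|[|[|]]]].
have : j \in [:: i1; i2; i3] by case: j => [[|[|[|]]]].
rewrite !inE => /or3P[] /eqP-> /or3P[] /eqP->; rewrite /tnth /= ?subrr;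
  rewrite !(mderivB, mderivD, mderivM, mderivXU, mderiv0, mderiv1, expr2) /=;
  rewrite !(mevalB, mevalD, mevalM, mevalXU, meval0, meval1) /tnth /= /t; ring.
Qed.

Lemma nagata_not_strongly_nilpotent :
  [pchar K] =i pred0 -> ~ strongly_nilpotent (nagata K).
Proof.
move=> /pcharf0P charK0.
(* The middle factor is taken at (0, 1, 0), the two outer ones at (0, 0, 1). *)
pose y (k : 'I_3) := tnth [tuple 0; (k == 1 :> nat)%:R; (k != 1 :> nat)%:R : K].
move=> /(meval_strongly_nilpotent y) /matrixP /(_ i2 i1).
rewrite !big_ord_recl big_ord0 mulr1 -!/(J _) !nagata_jacobian /=.
rewrite !mxE /= !big_ord_recl big_ord0 !mxE /= !big_ord_recl !big_ord0 !mxE /=.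
(* The entry in [prod0] simplifies to 1 * (- 6) * 1. *)
move=> prod0; have /eqP : (6%:R : K) = 0.
  rewrite -oppr0 -[in RHS]prod0; ring.
by rewrite charK0.
Qed.

End Nagata.

Theorem mainTheorem2 (K : fieldType) (charK0 : [pchar K]%R =i pred0) :
  pascal_finite (nagata K) /\ ~ strongly_nilpotent (nagata K).
Proof.
split; first exact: nagata_pascal_finite.
exact: nagata_not_strongly_nilpotent.
Qed.
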